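(* Let $F$ be a properly parametrized Markov multi-map of $[0,1]$, with forward trajectory system $(X,T)$ and inverse limit system $(Y,S)$. If $(X,T)$ is topologically transitive, then $(Y,S)$ is topologically transitive.
   Context: **Markov multi-maps.** $2^{[0,1]}$ denotes the set of closed subsets of $[0,1]$. A Markov multi-map of $[0,1]$ is given by a tuple $F=(P,\mathcal{A}_0,\mathcal{A}_1,\mathcal{A}_2,D,R,\{f_a\}_{a\in\mathcal{A}_0})$ such that: (1) $P=\{p_0,\dots,p_r\}$ with $0=p_0<\dots<p_r=1$; (2) $\mathcal{A}=\mathcal{A}_0\sqcup\mathcal{A}_1\sqcup\mathcal{A}_2$ is a finite set; (3) $D:\mathcal{A}\to 2^{[0,1]}$, and for each $a\in\mathcal{A}$ there is $p_i\in P$ with $D(a)=[p_i,p_{i+1}]$ if $a\in\mathcal{A}_0$ and $D(a)=\{p_i\}$ if $a\in\mathcal{A}_1\cup\mathcal{A}_2$; (4) $R:\mathcal{A}\to 2^{[0,1]}$, and for each $a\in\mathcal{A}$ there are $u\le v$ in $P$ with $R(a)=[u,v]$, where $u<v$ if $a\in\mathcal{A}_0$; $u<v$ and $R(a)\cap P=\{u,v\}$ if $a\in\mathcal{A}_1$; $u=v$ if $a\in\mathcal{A}_2$; (5) for each $a\in\mathcal{A}_0$, $f_a:D(a)\to R(a)$ is a homeomorphism; (6) $[0,1]=\bigcup_{a\in\mathcal{A}}D(a)$. For $a\in\mathcal{A}_0$ let $G(a)$ be the graph of $f_a$; for $a\in\mathcal{A}_1\cup\mathcal{A}_2$ let $G(a)=D(a)\times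 R(a)$. The multi-map $F:[0,1]\to 2^{[0,1]}$ has graph $G(F)=\bigcup_{a\in\mathcal{A}}G(a)$, i.e. $y\in F(x)$ iff $(x,y)\in G(F)$. If $a\in\mathcal{A}_0$ with $D(a)=[p_i,p_{i+1}]$, let $G_0(a)$ be the graph of $f_a|_{(p_i,p_{i+1})}$; if $a\in\mathcal{A}_1$ with $D(a)=\{p\}$, $R(a)=[u,v]$, let $G_0(a)=\{p\}\times(u,v)$; if $a\in\mathcal{A}_2$ with $D(a)=\{p\}$, $R(a)=\{q\}$, let $G_0(a)=\{(p,q)\}$. $F$ is properly parametrized if $\{G_0(a):a\in\mathcal{A}\}$ is a partition of $G(F)$. **Systems.** $X=\{x\in[0,1]^{\mathbb{Z}_{\ge0}}:x_{k+1}\in F(x_k)\ \forall k\ge0\}$ with $T:X\to X$, $T(x)_k=x_{k+1}$. $Y=\{y\in[0,1]^{\mathbb{Z}_{\le0}}:y_{k+1}\in F(y_k)\ \forall k\le-1\}$ with $S:Y\to Y$, $S(y)_k=y_{k-1}$. Both carry the subspace topology of the product topology. A system $(Z,f)$ is topologically transitive if for all nonempty open $U,V\subset Z$ there is $n\ge0$ with $f^n(U)\cap V\ne\emptyset$. *)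

(* Defs.v *)
From HB Require Import structures.
From mathcomp Require Import all_boot all_order all_algebra.
From mathcomp Require Import all_classical all_reals all_analysis.
Import Order.TTheory GRing.Theory Num.Theory.
Import numFieldNormedType.Exports.

Set Implicit Arguments.
Unset Strict Implicit.
Unset Printing Implicit Defensive.

Local Open Scope classical_set_scope.
Local Open Scope ring_scope.

(* Only the values of [f] on [A] matter. *)
Definition homeomorphism_between (R : realType) (A B : set R) (f : R -> R) :=
  [/\ set_fun A B f, {within A, continuous f} &
      exists g : R -> R,
        [/\ set_fun B A g, {within B, continuous g},
            {in A, cancel f g} & {in B, cancel g f}] ].

(* The alphabet is the disjoint union [mm_A0 + mm_A1 + mm_A2].  The values
   [mm_p i] for [i > mm_r], and those of [mm_f a] outside [mm_dom (mm_l0 a)],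
   are irrelevant. *)
Record markov_multimap (R : realType) := MarkovMultimap {
  mm_r : nat;
  mm_p : nat -> R;
  mm_p0 : mm_p 0 = 0;
  mm_pr : mm_p mm_r = 1;
  mm_p_lt : forall i, (i < mm_r)%N -> mm_p i < mm_p i.+1;
  mm_P : set R := mm_p @` [set i | (i <= mm_r)%N];
  mm_A0 : finType;
  mm_A1 : finType;
  mm_A2 : finType;
  mm_A : finType := (mm_A0 + mm_A1 + mm_A2)%type;
  mm_l0 : mm_A0 -> mm_A := fun a => inl (inl a);
  mm_l1 : mm_A1 -> mm_A := fun a => inl (inr a);
  mm_l2 : mm_A2 -> mm_A := fun a => inr a;
  mm_dom : mm_A -> set R;
  mm_ran : mm_A -> set R;
  mm_dom0 : forall a : mm_A0,
    exists2 i, (i < mm_r)%N & mm_dom (mm_l0 a) = `[mm_p i, mm_p i.+1]%classic;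
  mm_dom1 : forall a : mm_A1,
    exists2 i, (i <= mm_r)%N & mm_dom (mm_l1 a) = [set mm_p i];
  mm_dom2 : forall a : mm_A2,
    exists2 i, (i <= mm_r)%N & mm_dom (mm_l2 a) = [set mm_p i];
  mm_ran0 : forall a : mm_A0,
    exists u v, [/\ mm_P u, mm_P v, u < v & mm_ran (mm_l0 a) = `[u, v]%classic ];
  mm_ran1 : forall a : mm_A1,
    exists u v, [/\ mm_P u, mm_P v, u < v, mm_ran (mm_l1 a) = `[u, v]%classic &
                    mm_ran (mm_l1 a) `&` mm_P = [set u; v] ];
  mm_ran2 : forall a : mm_A2,
    exists u, mm_P u /\ mm_ran (mm_l2 a) = `[u, u]%classic;
  mm_f : mm_A0 -> R -> R;
  mm_f_homeo : forall a : mm_A0,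
    homeomorphism_between (mm_dom (mm_l0 a)) (mm_ran (mm_l0 a)) (mm_f a);
  mm_cover : `[0, 1]%classic = \bigcup_(a in [set: mm_A]) mm_dom a
}.

Section MarkovMultimap.
Context {R : realType} (F : markov_multimap R).

Definition letter_graph (a : mm_A F) : set (R * R) :=
  match a with
  | inl (inl b) =>
      [set xy | mm_dom (mm_l0 b) xy.1 /\ xy.2 = mm_f b xy.1]
  | _ => mm_dom a `*` mm_ran a
  end.

Definition open_letter_graph (a : mm_A F) : set (R * R) :=
  match a with
  | inl (inl b) =>
      [set xy | exists i, [/\ (i < mm_r F)%N,
         mm_dom (mm_l0 b) = `[mm_p F i, mm_p F i.+1]%classic,
         xy.1 \in `]mm_p F i, mm_p F i.+1[ & xy.2 = mm_f b xy.1] ]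
  | inl (inr b) =>
      [set xy | exists u v, [/\ mm_ran (mm_l1 b) = `[u, v]%classic,
         mm_dom (mm_l1 b) xy.1 & xy.2 \in `]u, v[] ]
  | inr b => mm_dom (mm_l2 b) `*` mm_ran (mm_l2 b)
  end.

Definition multimap_graph : set (R * R) :=
  \bigcup_(a in [set: mm_A F]) letter_graph a.

Definition multimap_val (x : R) : set R := [set y | multimap_graph (x, y)].

Definition properly_parametrized :=
  partition (range open_letter_graph) id multimap_graph.

Definition forward_set : set {ptws nat -> R} :=
  [set x | (forall k, x k \in `[0, 1]) /\
           forall k, multimap_val (x k) (x k.+1)].

(* Sequences indexed by the nonpositive integers are encoded by
   [y n] = y_{-n}; thus y_{k+1} \in F(y_k) with k = -(n+1) reads
   [multimap_val (y n.+1) (y n)], and S(y)_k = y_{k-1} is a shift of [n]. *)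
Definition inverse_set : set {ptws nat -> R} :=
  [set y | (forall n, y n \in `[0, 1]) /\
           forall n, multimap_val (y n.+1) (y n)].

Lemma forward_set_shift (x : {ptws nat -> R}) :
  forward_set x -> forward_set (fun k => x k.+1).
Proof. by case=> x01 xF; split=> k; [exact: x01 | exact: xF]. Qed.

Lemma inverse_set_shift (y : {ptws nat -> R}) :
  inverse_set y -> inverse_set (fun n => y n.+1).
Proof. by case=> y01 yF; split=> n; [exact: y01 | exact: yF]. Qed.

(* The carriers [set_type _] have the subspace topology of the product
   topology. *)
Definition forward_space : topologicalType := set_type forward_set.

Definition inverse_space : topologicalType := set_type inverse_set.

Definition forward_shift (x : forward_space) : forward_space :=
  SigSub (mem_set (forward_set_shift (set_valP x))).

Definition inverse_shift (y : inverse_space) : inverse_space :=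
  SigSub (mem_set (inverse_set_shift (set_valP y))).

End MarkovMultimap.

Definition topologically_transitive (Z : topologicalType) (f : Z -> Z) :=
  forall U V : set Z, open U -> open V -> U !=set0 -> V !=set0 ->
  exists n : nat, (iter n f @` U) `&` V !=set0.

(* Main.v *)
(* Transitivity of X forces the multi-map to be onto [0, 1], so finite
   trajectories extend indefinitely into the past as well as into the future.
   Open subsets of X and of Y are then both described by finite trajectories;
   an orbit of X going from the reversal of a finite window of v to that of u,
   read backwards and extended into the past, is a point of Y near u that is
   moved by S near v. *)

Require Import Defs.
From mathcomp Require Import all_boot all_order all_algebra.
From mathcomp Require Import all_classical all_reals all_analysis.
From mathcomp Require Import lra.
Import Order.TTheory GRing.Theory Num.Theory.
Import numFieldNormedType.Exports.

Set Implicit Arguments.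
Unset Strict Implicit.
Unset Printing Implicit Defensive.

Local Open Scope classical_set_scope.
Local Open Scope ring_scope.

(** This serves both directions of time: [Q] will be the multi-map relation or its converse. As [w]
    is listed backwards, induction on [m] only prepends [w m.+1]; choices are made only beyond
    [w 0]. *)
Lemma extend_reversed_path {T : Type} (A : set T) (Q : T -> T -> Prop)
    (w : nat -> T) (m : nat) :
  (forall a, A a -> exists2 b, A b & Q a b) ->
  (forall k, (k <= m)%N -> A (w k)) ->
  (forall k, (k < m)%N -> Q (w k.+1) (w k)) ->
  exists z : nat -> T, [/\ forall k, A (z k), forall k, Q (z k) (z k.+1) &
    forall i, (i <= m)%N -> z i = w (m - i)%N].
Proof.
move=> Qtot; elim: m => [|m IHm] wA wQ.
  have [s sP] : {s : T -> T & forall a, A a -> A (s a) /\ Q a (s a)}.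
    (* A choice function must be defined on all of [T]; outside [A] it takes the dummy value [a]. *)
    apply: (@choice _ _ (fun a b => A a -> A b /\ Q a b)) => a.
    have [/Qtot[b Ab Qab]|nAa] := pselect (A a); first by exists b.
    by exists a.
  have iterA k : A (iter k s (w 0%N)).
    by elim: k => [|k IHk] /=; [exact: wA | case: (sP _ IHk)].
  exists (fun k => iter k s (w 0%N)); split=> // [k|i].
    by case: (sP _ (iterA k)).
  by rewrite leqn0 => /eqP->.
have [z [zA zQ zw]] := IHm (fun k km => wA k (leqW km))
  (fun k km => wQ k (leqW km)).
exists (fun k => if k is k'.+1 then z k' else w m.+1); split.
- by case=> //; exact: wA.
- by case=> [|k] //; rewrite zw // subn0; exact: wQ.
- by case=> [|i] // im; rewrite zw // subSS.
Qed.

Section Cylinder.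
Context {R : realType}.
Implicit Types y : {ptws nat -> R}.

(** One index controls both the number of coordinates and the radius, so two neighbourhood
    conditions can be met by a single [m]. *)
Definition cylinder y (m : nat) : set {ptws nat -> R} :=
  [set x | forall i, (i <= m)%N -> ball (y i) m.+1%:R^-1 (x i)].

(** The sets containing almost all cylinders form a filter [G]. Containing every neighbourhood of
    [y] means that [G] converges to [y], which may be tested coordinate by coordinate. *)
Lemma nbhs_cylinder y (B : set {ptws nat -> R}) :
  nbhs y B -> \forall m \near \oo, cylinder y m `<=` B.
Proof.
pose G : set_system {ptws nat -> R} :=
  [set C | \forall m \near \oo, cylinder y m `<=` C].
have GF : Filter G.
  split=> [|C D|C D CD].
  - by rewrite /G /=; apply: nearW => m.
  - rewrite /G /=; apply: filterS2 => m Cm Dm x xm.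
    by split; [exact: Cm | exact: Dm].
  - by rewrite /G /=; apply: filterS => m Cm x /Cm /CD.
apply: (iffRL (pointwise_cvgP y GF)) => t.
apply/cvg_ballP => e e0; change (\forall m \near \oo,
  cylinder y m `<=` [set x | ball (y t) e (x t)]).
near=> m => x xm /=.
have tm : (t <= m)%N by near: m; exact: nbhs_infty_ge.
apply: le_ball (xm t tm); apply: ltW.
by near: m; exact: near_infty_natSinv_lt (PosNum e0).
Unshelve. all: by end_near. Qed.

Lemma open_box (A : nat -> set R) (m : nat) : (forall i, open (A i)) ->
  open [set x : {ptws nat -> R} | forall i, (i <= m)%N -> A i (x i)].
Proof.
move=> Aop.
have -> : [set x : {ptws nat -> R} | forall i, (i <= m)%N -> A i (x i)] =
    \bigcap_(i in `I_m.+1) (@proj nat (fun=> R) i @^-1` A i) by [].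
elim: m => [|m IHm].
  by rewrite II1 bigcap_set1; apply: open_comp => // x _; exact: proj_continuous.
rewrite IIS bigcap_setU bigcap_set1; apply: openI => //.
by apply: open_comp => // x _; exact: proj_continuous.
Qed.

End Cylinder.

Section Multimap.
Context {R : realType} (F : markov_multimap R).
Local Notation I01 := (`[0, 1]%classic : set R).

Lemma mm_P01 : mm_P F `<=` I01.
Proof.
have le_p d i : (i + d <= mm_r F)%N -> mm_p F i <= mm_p F (i + d).
  elim: d => [|d IHd]; first by rewrite addn0.
  rewrite addnS => id; apply: le_trans (IHd (ltnW id)) _.
  exact/ltW/mm_p_lt.
move=> _ [i /= ir <-]; rewrite in_itv /= -(mm_p0 F) -(mm_pr F).
apply/andP; split; first exact: (le_p i 0%N).
by rewrite -(subnKC ir) le_p // subnKC.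
Qed.

Lemma mm_dom01 (a : mm_A F) : mm_dom a `<=` I01.
Proof. by move=> x ax; rewrite (mm_cover F); exists a. Qed.

Lemma mm_ran_itv (a : mm_A F) : exists u v,
  [/\ mm_P F u, mm_P F v, u <= v & mm_ran a = `[u, v]%classic].
Proof.
case: a => [[a|a]|a].
- by have [u [v [Pu Pv /ltW uv ?]]] := mm_ran0 a; exists u, v.
- by have [u [v [Pu Pv /ltW uv ? _]]] := mm_ran1 a; exists u, v.
- by have [u [Pu ?]] := mm_ran2 a; exists u, u.
Qed.

Lemma mm_ran01 (a : mm_A F) : mm_ran a `<=` I01.
Proof.
have [u [v [/mm_P01 + /mm_P01 + _ ->]]] := mm_ran_itv a.
rewrite /= !in_itv /= => /andP[u0 _] /andP[_ v1] x /=.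
rewrite !in_itv /= => /andP[ux xv].
by rewrite (le_trans u0 ux) (le_trans xv v1).
Qed.

Lemma letter_graph_ran (a : mm_A F) x y : letter_graph a (x, y) -> mm_ran a y.
Proof.
case: a => [[a|a]|a] /=; [|by case..].
by case=> ax ->; have [fa _ _] := mm_f_homeo a; exact: fa.
Qed.

Lemma letter_graph_total (a : mm_A F) x :
  mm_dom a x -> exists y, letter_graph a (x, y).
Proof.
case: a => [[a|a]|a] ax; first by exists (mm_f a x).
- have [u [v [_ _ /ltW uv ranE _]]] := mm_ran1 a.
  by exists u; split=> //=; rewrite ranE /= in_itv /= lexx.
- have [u [_ ranE]] := mm_ran2 a.
  by exists u; split=> //=; rewrite ranE /= in_itv /= lexx.
Qed.

Lemma letter_graph_onto (a : mm_A F) y :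
  mm_ran a y -> exists2 x, mm_dom a x & letter_graph a (x, y).
Proof.
case: a => [[a|a]|a] ay.
- have [_ _ [g [gB _ _ gK]]] := mm_f_homeo a.
  by exists (g y); [exact: gB | split; [exact: gB | rewrite /= gK // inE]].
- by have [i _ domE] := mm_dom1 a; exists (mm_p F i); last split=> //=;
    rewrite domE.
- by have [i _ domE] := mm_dom2 a; exists (mm_p F i); last split=> //=;
    rewrite domE.
Qed.

Lemma multimap_val_total x : I01 x -> exists2 y, I01 y & multimap_val F x y.
Proof.
rewrite {1}(mm_cover F) => -[a _ /letter_graph_total[y axy]].
by exists y; [exact: mm_ran01 (letter_graph_ran axy) | exists a].
Qed.

(** Reversing a window of a point of Y gives a finite trajectory; it continues into the future
    because the domains cover [0, 1]. *)
Lemma forward_through (w : {ptws nat -> R}) (m : nat) : inverse_set F w ->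
  exists x : forward_space F, forall i, (i <= m)%N -> \val x i = w (m - i)%N.
Proof.
move=> [w01 wF].
have [z [z01 zF zw]] := extend_reversed_path (m := m) multimap_val_total
  (fun k _ => w01 k) (fun k _ => wF k).
have zX : forward_set F z by [].
by exists (SigSub (mem_set zX)).
Qed.

Lemma val_iter_forward n (x : forward_space F) k :
  \val (iter n (@forward_shift R F) x) k = \val x (n + k)%N.
Proof. by elim: n k => [|n IHn] k //=; rewrite IHn addnS. Qed.

Lemma val_iter_inverse n (y : inverse_space F) k :
  \val (iter n (@inverse_shift R F) y) k = \val y (n + k)%N.
Proof. by elim: n k => [|n IHn] k //=; rewrite IHn addnS. Qed.

Lemma forward_valP (x : forward_space F) : forward_set F (\val x).
Proof. exact: set_valP. Qed.

Lemma open_forward_box (A : nat -> set R) (m : nat) : (forall i, open (A i)) ->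
  open [set x : forward_space F | forall i, (i <= m)%N -> A i (\val x i)].
Proof. by move=> Aop; eexists; first exact: (open_box m Aop). Qed.

Hypothesis X_transitive : topologically_transitive (@forward_shift R F).

(* If y were missed, a ball around it would be disjoint from the closed union
   of the ranges, and trajectories could start in it but never enter it later:
   those starting away from y would never reach it. *)
Lemma transitive_multimap_val_onto y :
  I01 y -> exists2 x, I01 x & multimap_val F x y.
Proof.
move=> y01; pose K : set R := \bigcup_(a in [set: mm_A F]) mm_ran a.
suff [a _ /letter_graph_onto[x ax axy]] : K y.
  by exists x; [exact: mm_dom01 ax | exists a].
apply: contrapT => nKy.
have Kcl : closed K.
  apply: closed_bigcup => [|a _]; first exact: finite_finset.
  by have [u [v [_ _ _ ->]]] := mm_ran_itv a; exact: itv_closed.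
have /nbhs_ballP[e /= e0 eK] : nbhs y (~` K).
  by apply: open_nbhs_nbhs; split=> //; exact: closed_openC.
(* The bound [e] keeps the ball off [K]; the bound 1/4 leaves 0 or 1 farther than [d] from [y], so
   that [U] below is nonempty. *)
pose d := Num.min e 4^-1.
have d0 : 0 < d by rewrite lt_min e0 /=; lra.
have d4 : d <= 4^-1 by rewrite ge_min lexx orbT.
have start c : I01 c -> exists x : forward_space F, \val x 0%N = c.
  move=> c01.
  have [z [z01 zF zc]] := extend_reversed_path (m := 0) multimap_val_total
    (w := fun=> c) (fun k _ => c01) (fun k (kN : false) => False_ind _ (notF kN)).
  have zX : forward_set F z by [].
  by exists (SigSub (mem_set zX)); rewrite /= zc.
pose U := [set x : forward_space F |
  forall i, (i <= 0)%N -> (~` closed_ball y d) (\val x i)].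
pose V := [set x : forward_space F |
  forall i, (i <= 0)%N -> ball y d (\val x i)].
have U0 : U !=set0.
  have [c c01 yc] : exists2 c : R, I01 c & d < `|y - c|.
    move: y01; rewrite /= in_itv /= => /andP[y0 y1].
    have [y12|y12] := leP y 2^-1.
      exists 1; first by rewrite /= in_itv /= ler01 lexx.
      by rewrite ltr0_norm; lra.
    exists 0; first by rewrite /= in_itv /= ler01 lexx.
    by rewrite gtr0_norm; lra.
  have [x xc] := start c c01; exists x => i.
  rewrite leqn0 => /eqP ->; rewrite xc closed_ballE //= /closed_ball_ /=.
  by apply/negP; rewrite -ltNge.
have V0 : V !=set0.
  have [x xy] := start y y01; exists x => i; rewrite leqn0 => /eqP ->.
  by rewrite xy; exact: ballxx.
have Uop : open U.
  apply: (open_forward_box (A := fun=> ~` closed_ball y d)) => _.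
  by apply: closed_openC; exact: closed_ball_closed.
have Vop : open V.
  by apply: (open_forward_box (A := fun=> ball y d)) => _; exact: ball_open.
have [n [_ [[x Ux <-] Vx]]] := X_transitive Uop Vop U0 V0.
have := Vx 0%N isT; rewrite val_iter_forward addn0.
(* At time 0 the orbit is still in [U], disjoint from [V]; any later coordinate lies in some range,
   hence in [K]. *)
case: n {Vx} => [|n] yx.
  by apply: (Ux 0%N isT); exact: subset_closed_ball.
have [_ /(_ n)[a _ /letter_graph_ran axn]] := forward_valP x.
apply: (eK (\val x n.+1)); last by exists a.
by apply: le_ball yx; rewrite ge_min lexx.
Qed.

(** Dual to [forward_through]: past the index [m], where [x 0] sits, the sequence continues through
    preimages, which exist by surjectivity. *)
Lemma inverse_through (x : forward_space F) (m : nat) :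
  exists y : inverse_space F, forall i, (i <= m)%N -> \val y i = \val x (m - i)%N.
Proof.
have [x01 xF] := forward_valP x.
have [z [z01 zF zx]] := extend_reversed_path (m := m) transitive_multimap_val_onto
  (fun k _ => x01 k) (fun k _ => xF k).
have zY : inverse_set F z by [].
by exists (SigSub (mem_set zY)).
Qed.

End Multimap.

Theorem proposition7p4 (R : realType) (F : markov_multimap R)
    (F_proper : properly_parametrized F)
    (X_transitive : topologically_transitive (@forward_shift R F)) :
  topologically_transitive (@inverse_shift R F).
Proof.
move=> _ _ [U Uop <-] [V Vop <-] [u Uu] [v Vv].
have [m [um vm]] : exists m,
    cylinder (\val u) m `<=` U /\ cylinder (\val v) m `<=` V.
  have nU := nbhs_cylinder (open_nbhs_nbhs (conj Uop Uu)).
  have nV := nbhs_cylinder (open_nbhs_nbhs (conj Vop Vv)).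
  by have [m] := filter_ex (filterI nU nV); exists m.
(* The coordinates 0 to [m] of [x] follow those of [w] in reverse order, as time in Y is indexed
   backwards. *)
pose box (w : nat -> R) := [set x : forward_space F |
  forall i, (i <= m)%N -> ball (w (m - i)%N) m.+1%:R^-1 (\val x i)].
have box_open w : open (box w).
  apply: (@open_forward_box R F (fun i => ball (w (m - i)%N) m.+1%:R^-1) m) => i.
  exact: ball_open.
have box0 (w : inverse_space F) : box (\val w) !=set0.
  have [x xw] := forward_through m (set_valP w).
  by exists x => i im; rewrite xw //; exact: ballxx.
(* The orbit starts near [v] and ends near [u], since reversal exchanges source and target. *)
have [n [_ [[x vx <-] ux]]] :=
  X_transitive _ _ (box_open _) (box_open _) (box0 v) (box0 u).
(* The window must reach index [n + m]: coordinates 0 to [m] of [y] retrace [x] from time [n + m]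
   down to [n], and coordinates [n] to [n + m] retrace it from [m] down to 0. *)
have [y yx] := inverse_through X_transitive x (n + m).
exists n, (iter n (@inverse_shift R F) y); split.
  exists y => //; apply: um => i im.
  rewrite [set_val y i]yx ?(leq_trans im) ?leq_addl // -addnBA // -val_iter_forward.
  by have := ux (m - i)%N (leq_subr _ _); rewrite subKn.
apply: vm => i im.
rewrite [set_val _ i]val_iter_inverse yx ?leq_add2l // subnDl.
by have := vx (m - i)%N (leq_subr _ _); rewrite subKn.
Qed.
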